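(* Let $t \geq 4$ and $n \geq 1$ be integers, let $t' = [t/2]$, $x = \left[\frac{nt'-1}{t'-1}\right]$, and write $x-2 = tq + r$ with integers $q$ and $0 \leq r \leq t-1$. Let $R = R_{t-2,t}(K_{1,n})$. Then $R = x-1$ if and only if one of the following conditions holds: (a) $r = 1$, $\frac{2q+9}{3} < t \leq q+4$, $t$ is odd, and $x$ is even; (b) $r = 1$, $\frac{2q+9}{3} < t \leq q+4$, $t$ is odd, and $x$ is odd; (c) $1 < r < t-2$ and $\frac{2q+2r+7}{3} < t \leq q+r+3$ and $t$ is odd; (d) $r = t-2$ and either $t$ is even, or $t$ is odd and $t > \frac{2q+2r+7}{3}$.
   Context: $[a]$ denotes the integer part (floor) of a real number $a$. $K_{1,n}$ is the star with $n$ edges. For a graph $G$ and integers $1 \leq s < t$, $R_{s,t}(G)$ is the smallest positive integer $N$ such that every coloring of the edges of the complete graph $K_N$ with $t$ colors contains a (not necessarily induced) subgraph isomorphic to $G$ whose edges use at most $s$ distinct colors. *)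

(* Defs.v *)
From mathcomp Require Import all_boot all_order all_algebra.
Set Implicit Arguments. Unset Strict Implicit. Unset Printing Implicit Defensive.

Record graph := Graph {
  gV : finType;
  gE : rel gV;
  gE_sym : symmetric gE;
  gE_irr : irreflexive gE }.

(* A t-colouring of the edges of K_N: a symmetric map on pairs of vertices
   (values on the diagonal are irrelevant). *)
Definition edge_coloring (N t : nat) (c : 'I_N -> 'I_N -> 'I_t) : Prop :=
  forall i j, c i j = c j i.

Definition colors_of (G : graph) (N t : nat) (c : 'I_N -> 'I_N -> 'I_t)
  (f : gV G -> 'I_N) : {set 'I_t} :=
  [set c (f u) (f v) | u in gV G, v in [pred v | gE u v]].

(* Every t-colouring of K_N contains a copy of G (injective vertex map; K_N is
   complete so all edges are present) using at most s colours. *)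
Definition ramsey_prop (s t : nat) (G : graph) (N : nat) : Prop :=
  forall c : 'I_N -> 'I_N -> 'I_t, edge_coloring c ->
    exists f : gV G -> 'I_N, injective f /\ #|colors_of c f| <= s.

Definition is_R (s t : nat) (G : graph) (N : nat) : Prop :=
  0 < N /\ ramsey_prop s t G N /\
  forall M, 0 < M -> ramsey_prop s t G M -> N <= M.

(* The star K_{1,n}: centre None, leaves Some i. *)
Definition star_rel (n : nat) : rel (option 'I_n) :=
  fun u v => (u == None) != (v == None).

Lemma star_sym (n : nat) : symmetric (@star_rel n).
Proof. by move=> u v; rewrite /star_rel eq_sym. Qed.

Lemma star_irr (n : nat) : irreflexive (@star_rel n).
Proof. by move=> u; rewrite /star_rel eqxx. Qed.

Definition star (n : nat) : graph := @Graph (option 'I_n) (@star_rel n) (@star_sym n) (@star_irr n).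

(* Main.v *)
Require Import Defs.
From mathcomp Require Import all_boot all_order all_algebra.
From mathcomp Require Import zify.
Import Order.TTheory GRing.Theory Num.Theory.
Set Implicit Arguments. Unset Strict Implicit. Unset Printing Implicit Defensive.

(* A copy of K_{1,n} with at most t - 2 colours is avoided exactly when, at every
   vertex, any two colour degrees add up to at least m = N - n. Summing the
   degrees at one vertex forces t * ceil(m / 2) - (m mod 2) <= N - 1. Conversely
   explicit (near-)factorizations of K_N by sums or differences modulo N or N - 1
   attain this bound, apart from a parity obstruction when N and m / 2 are odd
   and N - 1 = t * m / 2, which never arises for odd t.

   With t' = h + 1 and n - 1 = p h + e, e < h, one gets x - 1 = p (h + 1) + e,
   so m is p - 1 for N = x - 1 and p - 2 for N = x - 2. For even t a colouring
   always exists at N = x - 1. For odd t the bound fails at x - 1 and holds at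
   x - 2 iff p = 2a with e < a < t - 1 + e, that is q = a - 1 and
   r = t - 1 - a + e. *)

(** * Colour degrees and monotonicity of the Ramsey property *)

Definition color_degree (N t : nat) (c : 'I_N -> 'I_N -> 'I_t) (v : 'I_N)
  (k : 'I_t) : nat := #|[pred w | (w != v) && (c v w == k)]|.

Definition pairwise_dense (N t m : nat) (c : 'I_N -> 'I_N -> 'I_t) : Prop :=
  forall v k l, k != l -> m <= color_degree c v k + color_degree c v l.

Lemma ramsey_prop_mono (s t : nat) (G : graph) (M N : nat) :
  M <= N -> ramsey_prop s t G M -> ramsey_prop s t G N.
Proof.
move=> leMN ramM c c_sym.
have [|f [f_inj f_col]] := ramM (fun i j => c (widen_ord leMN i) (widen_ord leMN j)).
  by move=> i j; apply: c_sym.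
exists (widen_ord leMN \o f); split=> // u v /= /(congr1 val) /= /val_inj.
exact: f_inj.
Qed.

(** By monotonicity, minimality only has to be checked at [N]; for [N = 0] the property fails
    because [u] has no image. *)
Lemma is_R_succ (s t : nat) (G : graph) (u : gV G) (N : nat) : 0 < t ->
  is_R s t G N.+1 <-> ramsey_prop s t G N.+1 /\ ~ ramsey_prop s t G N.
Proof.
move=> t_gt0; split=> [[_ [ramN minN]]|[ramN nramN]].
  split=> // ram; case: N => [|N] in ramN minN ram *.
    have [//|f _] := ram (fun _ _ => Ordinal t_gt0); by case: (f u).
  by have := minN N.+1 isT ram; rewrite ltnn.
do 2!split=> //; move=> M M_gt0 ramM; rewrite ltnNge; apply/negP=> leMN.
by apply: nramN; apply: ramsey_prop_mono ramM.
Qed.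

(** * Counting edges by colour at one vertex *)

Lemma sum_color_degree N t (c : 'I_N -> 'I_N -> 'I_t) v :
  \sum_k color_degree c v k = N.-1.
Proof.
have ->: N.-1 = #|[pred w | w != v]|.
  by rewrite -[N in LHS]card_ord (cardD1 v) inE /=; apply: eq_card => w; rewrite !inE andbT.
rewrite -sum1_card (partition_big (c v) xpredT) //=; apply: eq_bigr => k _.
by rewrite /color_degree -sum1_card; apply: eq_bigl => w; rewrite !inE.
Qed.

Lemma card_avoiding_colors N t (c : 'I_N -> 'I_N -> 'I_t) v k l : k != l ->
  #|[pred w | [&& w != v, c v w != k & c v w != l]]|
    + (color_degree c v k + color_degree c v l) = N.-1.
Proof.
move=> k_neq_l; rewrite -(sum_color_degree c v) (bigD1 k) //= (bigD1 l) 1?eq_sym //=.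
rewrite [RHS]addnA addnC; congr (_ + _).
rewrite -sum1_card (partition_big (c v) (fun i => (i != k) && (i != l))) /=; last first.
  by move=> w; rewrite inE => /and3P[_ -> ->].
apply: eq_bigr => i /andP[ik il]; rewrite /color_degree -sum1_card.
by apply: eq_bigl => w; rewrite !inE; case: (c v w =P i) => [->|_]; rewrite ?ik ?il ?andbT ?andbF.
Qed.

(** If some [d k] is below [uphalf m], all other values are at least [m - d k], and the bound
    [d k + (t - 1) * (m - d k)] is least at [d k = uphalf m - 1]. *)
Lemma pairwise_sum_ge t (d : 'I_t -> nat) m : 2 <= t ->
  (forall k l, k != l -> m <= d k + d l) -> t * uphalf m <= \sum_k d k + odd m.
Proof.
move=> t_ge2 d_pair; have [k lt_dk|ge_d] := pickP (fun k => d k < uphalf m); last first.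
  apply: leq_trans (leq_addr _ _); rewrite mulnC -[t in _ * t]card_ord mulnC -sum_nat_const.
  by apply: leq_sum => k _; rewrite leqNgt ge_d.
rewrite (bigD1 k) //=.
have: (t.-1) * (m - d k) <= \sum_(i | i != k) d i.
  have ->: t.-1 = #|[pred i | i != k]|.
    by rewrite -[t in LHS]card_ord (cardD1 k) inE /=; apply: eq_card => w; rewrite !inE andbT.
  rewrite -sum_nat_const; apply: leq_sum => i ik.
  by have := d_pair i k ik; lia.
move: (\sum_(i | _) _) => S; case: t t_ge2 {d_pair} d k lt_dk => [|[|t]] //= _ d k.
move: (d k) => y {d k}; nia.
Qed.

(** By counting, two colours share fewer than [N - n] edges at vertex 0, so at least [n] edges there
    avoid both. *)
Lemma star_ramsey_of_sparse t n N : 2 <= t -> 0 < N ->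
  N + odd (N - n) <= t * uphalf (N - n) -> ramsey_prop (t - 2) t (star n) N.
Proof.
move=> t_ge2 N_gt0 sparse c c_sym; pose v : 'I_N := Ordinal N_gt0.
have [k [l [kl lt_kl]]] : exists k l, k != l /\ color_degree c v k + color_degree c v l < N - n.
  have [k /existsP[l /andP[kl lt]]|none] := pickP (fun k => [exists l, (k != l) &&
      (color_degree c v k + color_degree c v l < N - n)]); first by exists k, l.
  have := @pairwise_sum_ge t (color_degree c v) (N - n) t_ge2.
  rewrite sum_color_degree => H; suff: N.+1 <= N by rewrite ltnn.
  have: t * uphalf (N - n) <= N.-1 + odd (N - n).
    apply: H => k l kl; have /existsPn/(_ l) := negbT (none k).
    by rewrite kl /= -leqNgt.
  by lia.
have := card_avoiding_colors c v kl; set A := [pred w | _] => cardA.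
have le_nA : n <= #|A| by lia.
pose f (u : option 'I_n) := if u is Some i then enum_val (widen_ord le_nA i) else v.
have fA i : f (Some i) \in A by apply: enum_valP.
exists f; split.
  move=> [i|] [j|] // eq_f.
  - by move/enum_val_inj/(congr1 val): eq_f => /= /val_inj ->.
  - by have := fA i; rewrite eq_f /A !inE eqxx.
  - by have := fA j; rewrite -eq_f /A !inE eqxx.
have sub : colors_of (G := star n) c f \subset ~: [set k; l].
  apply/subsetP=> _ /imset2P[a b _ ab ->]; rewrite inE in ab.
  case: a b ab => [i|] [j|] //= _.
  - by have := fA i; rewrite /A !inE c_sym => /and3P[_ /negbTE-> /negbTE->].
  - by have := fA j; rewrite /A !inE => /and3P[_ /negbTE-> /negbTE->].
have <-: #|~: [set k; l]| = t - 2 by rewrite cardsCs setCK cards2 kl card_ord.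
exact: subset_leq_card.
Qed.

(** A star with at most [t - 2] colours misses two colours; its [n] edges and the at least [N - n]
    edges of those colours at its centre exceed the degree [N - 1]. *)
Lemma not_star_ramsey_of_dense t n N (c : 'I_N -> 'I_N -> 'I_t) : 2 <= t ->
  edge_coloring c -> pairwise_dense (N - n) c -> ~ ramsey_prop (t - 2) t (star n) N.
Proof.
move=> t_ge2 c_sym dense /(_ c c_sym)[f [f_inj le_col]].
have : 1 < #|~: colors_of (G := star n) c f|.
  by have := cardsC (colors_of (G := star n) c f); rewrite card_ord; lia.
case/card_gt1P=> k [l [kS lS kl]].
have := dense (f None) k l kl; have := card_avoiding_colors c (f None) kl.
set A := [pred w | _] => cardA le_m.
have: n <= #|A|.
  have inj_g : injective (fun i : 'I_n => f (Some i)) by move=> i j /f_inj[].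
  rewrite -[n]card_ord -(card_codom inj_g); apply/subset_leq_card/subsetP=> _ /codomP[i ->].
  have cS : c (f None) (f (Some i)) \in colors_of (G := star n) c f.
    by apply/imset2P; exists None (Some i).
  rewrite /A !inE; apply/and3P; split.
  - by apply/eqP=> /f_inj.
  - by apply: contraTneq cS => ->; rewrite in_setC in kS.
  - by apply: contraTneq cS => ->; rewrite in_setC in lS.
by have := ltn_ord (f None); lia.
Qed.

(** * Dense colourings from numbered edge classes *)

Lemma card_ge_index (T : finType) (A : {pred T}) (idx : T -> nat) b :
  (forall i, i < b -> exists2 w, w \in A & idx w = i) -> b <= #|A|.
Proof.
move=> idxP; rewrite -[b](size_iota 0) cardE -(size_map idx).
apply: uniq_leq_size (iota_uniq _ _) _ => i; rewrite mem_iota => /idxP[w wA <-].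
by apply: map_f; rewrite mem_enum.
Qed.

(** Colour [k] is the union of the classes [k], [t + k], [2 * t + k], and so on; the quotient by [t]
    tells these apart. *)
Definition mod_coloring (N t : nat) (t_gt0 : 0 < t) (cls : nat -> nat -> nat)
  (v w : 'I_N) : 'I_t := Ordinal (ltn_pmod (cls v w) t_gt0).

Lemma mod_coloringE N t (t_gt0 : 0 < t) (cls : nat -> nat -> nat) (v w : 'I_N) (k : 'I_t) i :
  cls v w = i * t + k -> mod_coloring t_gt0 cls v w = k /\ cls v w %/ t = i.
Proof.
move=> E; split; last by rewrite E divnMDl // divn_small // addn0.
by apply/val_inj; rewrite /= E modnMDl modn_small.
Qed.

Lemma mod_color_degree_ge N t (t_gt0 : 0 < t) (cls : nat -> nat -> nat) (v : 'I_N) (k : 'I_t) b :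
  (forall i, i < b -> exists w, [/\ w < N, w != v & cls v w = i * t + k]) ->
  b <= color_degree (mod_coloring t_gt0 cls) v k.
Proof.
move=> clsP; apply: (@card_ge_index _ _ (fun w : 'I_N => cls v w %/ t)) => i /clsP[w [wN wv E]].
have [cE iE] := @mod_coloringE N t t_gt0 cls v (Ordinal wN) k i E.
by exists (Ordinal wN); rewrite // inE cE eqxx andbT.
Qed.

(* For even N, a 1-factorization of K_N: the last vertex is the point at
   infinity, and the other pairs are classified by their sum modulo N - 1. *)
Lemma dense_coloring_even N t m : 0 < t -> ~~ odd N -> t * uphalf m < N + odd m ->
  exists2 c : 'I_N -> 'I_N -> 'I_t, edge_coloring c & pairwise_dense m c.
Proof.
move=> t_gt0 N_even tm; pose M := N.-1.
(* This is [2 * y] modulo [M]: the class that the loop at [y] would take goes to the edge from [y]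
   to infinity. *)
pose dbl y := if y.*2 < M then y.*2 else y.*2 - M.
pose cls v w := if v == M then dbl w else if w == M then dbl v else
  if v + w < M then v + w else v + w - M.
exists (mod_coloring t_gt0 cls).
  move=> v w; apply/val_inj; rewrite /= /cls addnC.
  have [vM|vM] := eqVneq (v : nat) M; have [wM|wM] := eqVneq (w : nat) M; rewrite ?vM ?wM //.
have deg_ge (v : 'I_N) (k : 'I_t) b : (b.-1) * t + k < M -> b <= color_degree (mod_coloring t_gt0 cls) v k.
  move=> bM; apply: mod_color_degree_ge => i ib.
  have : i * t + k < M by nia.
  move: (i * t + k) => u uM; have := ltn_ord v; move: (v : nat) => {ib bM}v vN.
  have [vM|vM] := eqVneq v M.
    (* [M] is odd, so [u] can be halved modulo [M]. *)
    exists (if odd u then (u + M)./2 else u./2); rewrite /cls /dbl vM eqxx.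
    by case: ifP => ou; split; try (case: ifP); lia.
  pose w := if v <= u then u - v else u + M - v.
  exists (if w == v then M else w); rewrite /cls /dbl (negbTE vM).
  rewrite /w; case: (leqP v u) => vu; case: eqP => wv; split; do ?case: ifP; lia.
move=> v k l kl; have kt := ltn_ord k; have lt := ltn_ord l.
have {}kl : k <> l :> nat by move/eqP: kl => kl /val_inj.
case: (boolP (odd m)) tm => om tm.
  have [b mE] : exists b, m = b.*2.+1 by exists m./2; lia.
  have {tm}tm : t * b.+1 <= N by move: tm; rewrite (_ : uphalf m = b.+1); lia.
  (* There are [N - 1 >= t * (b + 1) - 1] classes, so only colour [t - 1] can fall one short of
     [b + 1]. *)
  have [kt1|kt1] := eqVneq (k.+1) t.
    have := deg_ge v k b; have := deg_ge v l b.+1; nia.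
  have := deg_ge v l b; have := deg_ge v k b.+1; nia.
have mE : m = m./2.*2 by lia.
have {}tm : t * m./2 < N by move: tm; rewrite (_ : uphalf m = m./2); lia.
move: mE tm; move: (m./2) => b mE tm.
case: b mE tm => [->//|b] mE tm.
have dk : b.+1 <= color_degree (mod_coloring t_gt0 cls) v k by apply: deg_ge; rewrite /M /=; nia.
have dl : b.+1 <= color_degree (mod_coloring t_gt0 cls) v l by apply: deg_ge; rewrite /M /=; nia.
by lia.
Qed.

(* Sums modulo N meet every class at every vertex when loops are counted, and
   the loop at v lies in one colour only. *)
Lemma dense_coloring_odd_odd N t a : 0 < t -> t * a.+1 <= N ->
  exists2 c : 'I_N -> 'I_N -> 'I_t, edge_coloring c & pairwise_dense a.*2.+1 c.
Proof.
move=> t_gt0 taN; pose cls v w := if v + w < N then v + w else v + w - N.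
exists (mod_coloring t_gt0 cls); first by move=> v w; apply/val_inj; rewrite /= /cls addnC.
set c := mod_coloring t_gt0 cls => v.
have full k : a.+1 <= color_degree c v k + (c v v == k).
  have <-: #|[pred w | c v w == k]| = color_degree c v k + (c v v == k).
    by rewrite (cardD1 v) inE addnC; congr (_ + _); apply: eq_card => w; rewrite !inE.
  apply: (@card_ge_index _ _ (fun w : 'I_N => cls v w %/ t)) => i ia.
  have : i * t + k < N by have := ltn_ord k; nia.
  have vN := ltn_ord v.
  pose w u := if v <= u then u - v else u + N - v.
  move=> uN; have wN : w (i * t + k) < N by rewrite /w; case: ifP; lia.
  have [|cE iE] := @mod_coloringE N t t_gt0 cls v (Ordinal wN) k i.
    by rewrite /= /cls /w; do !case: ifP; lia.
  by exists (Ordinal wN); rewrite // inE /c cE.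
move=> k l kl; have := full k; have := full l.
suff : (c v v == k) + (c v v == l) <= 1 by lia.
by case: eqP => [->|_]; case: eqP => // E; rewrite E eqxx in kl.
Qed.

(* The sum classes 0 and 1 modulo N form a path through all vertices; its edges
   are recoloured so that each vertex v recovers the class 2v lost to the loop. *)
Lemma dense_coloring_odd_spare N t a : 0 < t -> odd N -> (t * a).+1 < N ->
  exists2 c : 'I_N -> 'I_N -> 'I_t, edge_coloring c & pairwise_dense a.*2 c.
Proof.
move=> t_gt0 N_odd taN.
(* The sum class [s] gets number [s - 2]. An edge of sum [N] serves its larger end, one of sum
   [N + 1] its smaller end. The edge between 0 and 1 gets [1 - 2 = 0] by truncation, the class lost
   at vertex 1. *)
pose cls v w := if v + w == N then (maxn v w).*2 - N - 2
  else if v + w == N.+1 then (minn v w).*2 - 2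
  else if v + w < N then v + w - 2 else v + w - N - 2.
exists (mod_coloring t_gt0 cls).
  by move=> v w; apply/val_inj; rewrite /= /cls addnC maxnC minnC.
have deg_ge (v : 'I_N) k : a <= color_degree (mod_coloring t_gt0 cls) v k.
  apply: mod_color_degree_ge => i ia.
  have : (i * t + k).+2 < N by have := ltn_ord k; nia.
  move: (i * t + k) => u uN; have := ltn_ord v; move: (v : nat) => {ia taN}v vN.
  have [uv|] := eqVneq u.+2 v.*2.
    exists (if v == 1 then 0 else N.+1 - v); rewrite /cls.
    by case: eqP => v1; split; do ?case: ifP; lia.
  have [uv|] := eqVneq (u.+2 + N) v.*2.
    by exists (N - v); rewrite /cls; split; do ?case: ifP; lia.
  exists (if v <= u.+2 then u.+2 - v else u.+2 + N - v); rewrite /cls.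
  by case: ifP; split; do ?case: ifP; lia.
by move=> v k l _; rewrite -addnn leq_add.
Qed.

(** Each cyclic distance from 1 to [t * b] modulo [N] gives a 2-regular graph, and every colour
    receives [b] of these distances. *)
Lemma dense_coloring_two_factors N t b : 0 < t -> N = (t * b).*2.+1 ->
  exists2 c : 'I_N -> 'I_N -> 'I_t, edge_coloring c & pairwise_dense b.*2.*2 c.
Proof.
move=> t_gt0 NE; pose dist v w := (v - w) + (w - v).
pose cls v w := (if (dist v w).*2 < N then dist v w else N - dist v w).-1.
exists (mod_coloring t_gt0 cls).
  by move=> v w; apply/val_inj; rewrite /= /cls /dist addnC.
have deg_ge (v : 'I_N) k : b.*2 <= color_degree (mod_coloring t_gt0 cls) v k.
  (* Separates the two vertices at equal cyclic distance from [v]: those ahead are indexed from 0,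
     those behind from [b]. *)
  pose fwd w := if v < w then (w - v).*2 < N else N < (v - w).*2.
  apply: (@card_ge_index _ _ (fun w : 'I_N => cls v w %/ t + (if fwd w then 0 else b))) => i ib.
  have [j [jb iE]] : exists j, j < b /\ i = j + (if i < b then 0 else b).
    by exists (if i < b then i else i - b); case: ifP; lia.
  have : (j * t + k).*2.+2 < N by have := ltn_ord k; nia.
  have vN := ltn_ord v; move=> uN.
  pose wi u := if i < b then (if v + u.+1 < N then v + u.+1 else v + u.+1 - N)
    else (if u < v then v - u.+1 else v + N - u.+1).
  have wN : wi (j * t + k) < N by rewrite /wi; do !case: ifP; lia.
  have [|cE jE] := @mod_coloringE N t t_gt0 cls v (Ordinal wN) k j.
    by rewrite /= /cls /dist /wi; do !case: ifP; lia.
  exists (Ordinal wN); rewrite ?jE ?inE ?cE ?eqxx ?andbT.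
    by apply/eqP=> /(congr1 val); rewrite /= /wi; do !case: ifP; lia.
  rewrite [RHS]iE; congr (_ + _); rewrite /fwd /wi /=.
  case: (i < b); [case: (ltnP (v + _)) | case: (ltnP _ v)] => ?; do !case: ifP; lia.
by move=> v k l _; rewrite -addnn leq_add.
Qed.

(** For odd [N] and even [m], either there is room to spare or [N - 1 = t * m./2]. In the tight case
    with [t > 2], each colour would be regular of degree [m./2], impossible on an odd number of
    vertices if [m./2] is odd; if it is even, 2-factors work. *)
Lemma dense_coloring N t m : 0 < t -> t * uphalf m < N + odd m ->
  ~~ [&& odd N, ~~ odd m, odd m./2 & N == (t * m./2).+1] ->
  exists2 c : 'I_N -> 'I_N -> 'I_t, edge_coloring c & pairwise_dense m c.
Proof.
move=> t_gt0 tm; have [N_odd|N_even _] := boolP (odd N); last exact: dense_coloring_even.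
case: (boolP (odd m)) tm => om tm /= exc.
  have mE : m = m./2.*2.+1 by lia.
  rewrite {}mE; apply: dense_coloring_odd_odd => //.
  by move: tm; rewrite (_ : uphalf m = m./2.+1); lia.
have mE : m = m./2.*2 by lia.
have {}tm : t * m./2 < N by move: tm; rewrite (_ : uphalf m = m./2); lia.
have [lt|] := boolP ((t * m./2).+1 < N).
  by rewrite mE; apply: dense_coloring_odd_spare.
move=> ge; have NE : N = (t * m./2).+1 by lia.
have em : ~~ odd m./2 by move: exc; rewrite NE eqxx andbT.
have m2E : m./2 = m./2./2.*2 by lia.
by rewrite mE m2E; apply: dense_coloring_two_factors => //; lia.
Qed.

(** * Thresholds for the star *)

Lemma not_star_ramsey t n N (m := N - n) : 2 <= t -> t * uphalf m < N + odd m ->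
  ~~ [&& odd N, ~~ odd m, odd m./2 & N == (t * m./2).+1] ->
  ~ ramsey_prop (t - 2) t (star n) N.
Proof.
move=> t_ge2 tm exc; have [|c c_sym dense] := dense_coloring _ tm exc; first exact: ltnW.
exact: not_star_ramsey_of_dense dense.
Qed.

(** If [t] and [m./2] are odd, [t * m./2 + 1] is even, so the parity obstruction is void and the
    counting bound is sharp. *)
Lemma star_ramsey_odd t n N (m := N - n) : 2 <= t -> odd t -> 0 < N ->
  ramsey_prop (t - 2) t (star n) N <-> N + odd m <= t * uphalf m.
Proof.
move=> t_ge2 t_odd N_gt0; split; last exact: star_ramsey_of_sparse.
move=> ram; rewrite leqNgt; apply/negP=> tm; apply: not_star_ramsey ram => //.
apply/negP=> /and4P[N_odd _ m2_odd /eqP NE].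
by move: N_odd; rewrite NE /= oddM t_odd m2_odd.
Qed.

(** * Arithmetic of [x] in terms of [p], [h] and [e] *)

Lemma star_quotientE h p e : e < h ->
  ((p * h + e).+1 * h.+1 - 1) %/ h = p * h.+1 + e + 1.
Proof.
move=> lt_eh; have -> : (p * h + e).+1 * h.+1 - 1 = (p * h.+1 + e + 1) * h + e by nia.
by rewrite divnMDl ?divn_small ?addn0 //; lia.
Qed.

Lemma not_star_ramsey_even h p e (t := h.+1.*2) (n := (p * h + e).+1) :
  e < h -> 0 < p * h.+1 + e -> ~ ramsey_prop (t - 2) t (star n) (p * h.+1 + e).
Proof.
move=> lt_eh N_gt0; have mE : p * h.+1 + e - n = p.-1 by rewrite /n; nia.
apply: not_star_ramsey; rewrite ?mE /t; first by lia.
  case: p N_gt0 {mE n} => [|p] N_gt0; first by rewrite muln0; lia.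
  by have [] : uphalf p = p./2 + odd p /\ p = p./2.*2 + odd p; [lia | move=> /= -> ?; nia].
(* The tight case would force [h + e = 0], against [e < h]. *)
apply/negP=> /and4P[_ p_even p_odd2 /eqP NE].
case: p p_even p_odd2 NE {N_gt0 mE n} => [|p] //= p_even _ NE.
have pE : p = p./2.*2 by lia.
by nia.
Qed.

(** For [p = 2a], [t * a = p * (h + 1) + a], so the bound fails at [p * (h + 1) + e] iff [e < a];
    subtracting [t] gives the upper limit on [a] from the bound one vertex below. *)
Lemma is_R_star_odd h p e (t := h.+1.*2.+1) (n := (p * h + e).+1) : e < h ->
  is_R (t - 2) t (star n) (p * h.+1 + e) <->
  exists a, [/\ p = a.*2, e < a & a < h.+1.*2 + e].
Proof.
move=> lt_eh; case NE : (p * h.+1 + e) => [|N].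
  by split=> [[]//|[a [pE ea _]]]; nia.
have mE1 : N.+1 - n = p.-1 by rewrite /n -NE; nia.
have mE2 : N - n = p.-2 by rewrite /n; nia.
have t_ge2 : 2 <= t by rewrite /t; lia.
have t_odd : odd t by rewrite /t; lia.
have [ram1 ram1'] := star_ramsey_odd n t_ge2 t_odd (ltn0Sn N).
rewrite mE1 in ram1 ram1'.
rewrite (@is_R_succ _ _ (star n) None) //.
case: (posnP N) => [N0|N_gt0].
  split=> [[/ram1 le1 _]|[a [pE ea _]]]; last by nia.
  by case: p le1 NE {ram1 ram1' mE1 mE2 n} => [|[|p]] /=; rewrite /t; nia.
rewrite (star_ramsey_odd n t_ge2 t_odd N_gt0) mE2.
split=> [[/ram1 le1 /negP]|[a [pE ea ah]]].
  rewrite -ltnNge => lt2; exists p./2.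
  have [b [pE|pE]] : exists b, p = b.*2 \/ p = b.*2.+1.
  - by exists p./2; lia.
  - case: b pE => [|b] pE; first by move: le1 lt2; rewrite pE /t /=; nia.
    have u1 : uphalf p.-1 = b.+1 by lia.
    have u2 : uphalf p.-2 = b by lia.
    have o1 : odd p.-1 by lia.
    have o2 : odd p.-2 = false by lia.
    move: le1 lt2; rewrite u1 u2 o1 o2 /t; split; nia.
  (* For odd [p] the two thresholds coincide, so the property cannot start to hold exactly here. *)
  - case: b pE => [|b] pE; first by move: le1 lt2; rewrite pE /t /=; nia.
    have u1 : uphalf p.-1 = b.+1 by lia.
    have u2 : uphalf p.-2 = b.+1 by lia.
    have o1 : odd p.-1 = false by lia.
    have o2 : odd p.-2 by lia.
    move: le1 lt2; rewrite u1 u2 o1 o2 /t; nia.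
case: a pE ea ah => [|b] pE ea ah; first by [].
have u1 : uphalf p.-1 = b.+1 by lia.
have u2 : uphalf p.-2 = b by lia.
have o1 : odd p.-1 by lia.
have o2 : odd p.-2 = false by lia.
split.
  by apply: ram1'; rewrite u1 o1 /t; nia.
by rewrite u2 o2 /t; apply/negP; rewrite -ltnNge; nia.
Qed.

Lemma quotient_conditions_odd (h p e : nat) (q r : int) (t := h.+1.*2.+1)
    (x := p * h.+1 + e + 1) : e < h ->
  (Posz x - 2 = q * Posz t + r)%R -> (0 <= r < Posz t)%R ->
  (exists a, [/\ p = a.*2, e < a & a < h.+1.*2 + e]) <->
  (1 <= r <= Posz t - 2)%R /\ (Posz t <= q + r + 3)%R
    /\ (2 * q + 2 * r + 7 < 3 * Posz t)%R.
Proof.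
move=> lt_eh; rewrite /x /t => xE r_bd; split=> [[a [pE ea ah]]|].
  have qE : q = (Posz a - 1)%R.
    by rewrite pE in xE; nia.
  have rE : r = (Posz h.+1.*2 - Posz a + Posz e)%R by rewrite pE qE in xE; nia.
  by lia.
case=> r_bd' [tq qt].
(* Put [e0 = q + r + 2 - t]. Then [p * (h + 1) + e = 2 * (q + 1) * (h + 1) + e0], and both [e] and
   [e0] lie between [-1] and [h - 1], a window of [h + 1] integers; hence [e = e0] and
   [p = 2 * (q + 1)]. *)
have pE : Posz p = (2 * (q + 1))%R by nia.
exists p./2.
have eE : Posz e = (q + r + 2 - Posz h.+1.*2.+1)%R by nia.
split; lia.
Qed.

Theorem theorem7 (t n : nat) (ht : 4 <= t) (hn : 1 <= n) :
  let t' := t./2 in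
  let x := (n * t' - 1) %/ (t' - 1) in
  let q : int := ((Posz x - 2) %/ Posz t)%Z in
  let r : int := ((Posz x - 2) %% Posz t)%Z in
  is_R (t - 2) t (star n) (x - 1) <->
  [\/ ((r = 1)%R /\ (2 * q + 9 < 3 * Posz t)%R /\ (Posz t <= q + 4)%R
         /\ odd t /\ ~~ odd x),
      ((r = 1)%R /\ (2 * q + 9 < 3 * Posz t)%R /\ (Posz t <= q + 4)%R
         /\ odd t /\ odd x),
      ((1 < r)%R /\ (r < Posz t - 2)%R /\ (2 * q + 2 * r + 7 < 3 * Posz t)%R
         /\ (Posz t <= q + r + 3)%R /\ odd t)
    | ((r = Posz t - 2)%R
         /\ (~~ odd t \/ (odd t /\ (2 * q + 2 * r + 7 < 3 * Posz t)%R)))].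
Proof.
move=> t' x q r.
have xE : (Posz x - 2 = q * Posz t + r)%R by apply: divz_eq.
have r_bd : (0 <= r < Posz t)%R by rewrite modz_ge0 ?ltz_pmod //; lia.
move: q r xE r_bd => q r xE r_bd.
pose h := t'.-1; pose p := n.-1 %/ h; pose e := n.-1 %% h.
have t'E : t' = h.+1 by rewrite /h /t'; lia.
have h_gt0 : 0 < h by rewrite /h /t'; lia.
have lt_eh : e < h by rewrite ltn_mod.
have nE : n = (p * h + e).+1 by rewrite -divn_eq prednK.
have xpE : x = p * h.+1 + e + 1 by rewrite /x t'E nE [h.+1 - 1]subn1 /= star_quotientE.
clearbody h p e; rewrite xpE in xE *; rewrite addnK nE.
have [t_odd|t_even] := boolP (odd t).
  have tE : t = h.+1.*2.+1 by rewrite -t'E /t'; lia.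
  rewrite {1 2}tE (is_R_star_odd _ lt_eh) quotient_conditions_odd -?tE; [|exact: lt_eh|exact: xE|exact: r_bd].
  split=> [[r1 [tq qt]]|].
    have [r1'|r1'] := eqVneq r 1%R.
      by case: (boolP (odd (p * h.+1 + e + 1))) => ox; [constructor 2|constructor 1]; lia.
    have [r2|r2] := eqVneq r (Posz t - 2)%R.
      by constructor 4; split=> //; right; lia.
    by constructor 3; lia.
  (* For [r = t - 2] the bound [t <= q + r + 3] amounts to [q >= -1], which follows from
     [x >= 1]. *)
  have q_ge : (-1 <= q)%R by nia.
  case=> [[r1 [? [? _]]]|[r1 [? [? _]]]|[r1 [r2 [? [? _]]]]|[r1 [//|[_ ?]]]]; lia.
have tE : t = h.+1.*2 by rewrite -t'E /t'; lia.
(* For even [t] both sides are false. *)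
split=> [[N_gt0 [ram _]]|].
  by exfalso; move: ram; rewrite tE; exact: not_star_ramsey_even.
case=> [[? [? [? []//]]]|[? [? [? []//]]]|[? [? [? [? //]]]]|[r1 _]].
(* [r = t - 2] makes [t] divide [x], so [h + 1] would divide [e + 1], yet [0 < e + 1 < h + 1]. *)
have : ((2 * (q + 1) - Posz p) * Posz h.+1 = Posz e + 1)%R by rewrite r1 tE in xE; lia.
move: (2 * (q + 1) - Posz p)%R lt_eh => d; clear=> lt_eh dE.
have [d_le0|d_gt0] : (d <= 0)%R \/ (1 <= d)%R by lia.
  by nia.
by nia.
Qed.
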